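(* Let $a\ne0$ be a real number, let $F=\{f_1<\cdots<f_k\}$ ($k\ge1$) be a finite set of positive integers and write $F_{\{k\}}=\{f_1,\dots,f_{k-1}\}$. Define the first order difference operators $$A_F=\frac{\Omega_F(x+1)}{\Omega_{F_{\{k\}}}(x+1)}\mathfrak{s}_0-\frac{\Omega_F(x)}{\Omega_{F_{\{k\}}}(x+1)}\mathfrak{s}_1,\qquad B_F=-x\frac{\Omega_{F_{\{k\}}}(x+1)}{\Omega_F(x)}\mathfrak{s}_{-1}+a\frac{\Omega_{F_{\{k\}}}(x)}{\Omega_F(x)}\mathfrak{s}_0 .$$ Then $c_n^F(x)=A_F\big(c_{n-f_k+k}^{F_{\{k\}}}\big)(x)$ for $n\in\sigma_F$. Moreover $$D_{F_{\{k\}}}=B_FA_F+(f_k+u_{F_{\{k\}}})\,\mathrm{Id},\qquad D_F=A_FB_F+(f_k+u_F)\,\mathrm{Id}.$$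
   Context: Shift operators: $\mathfrak{s}_l(p)(x)=p(x+l)$; $\mathrm{Id}=\mathfrak{s}_0$. Identities between operators are identities of difference operators with rational coefficients. Charlier polynomials ($a\ne0$): $c_n^a(x)=\frac1{n!}\sum_{j=0}^n(-a)^{n-j}\binom nj\binom xj j!$, $n\ge0$. For a finite set of positive integers $F=\{f_1<\cdots<f_k\}$: $u_F=\sum_{f\in F}f-\binom{k+1}{2}$; $\sigma_F=\{u_F,u_F+1,\dots\}\setminus\{u_F+f: f\in F\}$; for $n\in\sigma_F$, $c_n^F(x)=c_n^{a;F}(x)$ is the $(k+1)\times(k+1)$ determinant whose first row is $(c^a_{n-u_F}(x+j))_{j=0}^{k}$ and whose $(i+1)$-th row is $(c^a_{f_i}(x+j))_{j=0}^k$, $i=1,\dots,k$; $\Omega_F(x)=\Omega_F^a(x)=\det\big(c_{f_i}^a(x+j-1)\big)_{i,j=1}^k$; $\Lambda_F(x)$ is the $k\times k$ determinant with $i$-th row $(c_{f_i}^a(x),\dots,c_{f_i}^a(x+k-2),c_{f_i}^a(x+k))$; and $$D_F=-x\frac{\Omega_F(x+1)}{\Omega_F(x)}\mathfrak{s}_{-1}+\Big(x+k+a+u_F-a\frac{\Lambda_F(x+1)}{\Omega_F(x+1)}+a\frac{\Lambda_F(x)}{\Omega_F(x)}\Big)\mathfrak{s}_0-a\frac{\Omega_F(x)}{\Omega_F(x+1)}\mathfrak{s}_1 .$$ Conventions for the empty set ($k=0$): $u_\emptyset=0$, $\sigma_\emptyset=\mathbb{N}=\{0,1,2,\dots\}$,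 $\Omega_\emptyset=1$, $c_n^\emptyset=c_n^a$, $D_\emptyset=-x\mathfrak{s}_{-1}+(x+a)\mathfrak{s}_0-a\mathfrak{s}_1$. *)

(* Defs.v *)
From HB Require Import structures.
From mathcomp Require Import all_boot all_order all_algebra.
From mathcomp Require Import fraction.
From mathcomp Require Import reals zify.

Set Implicit Arguments.
Unset Strict Implicit.
Unset Printing Implicit Defensive.

Import Order.TTheory GRing.Theory Num.Theory.
Local Open Scope ring_scope.

Notation "x %:F" := (@tofrac _ x) : ring_scope.
Notation "{ 'ratfun' R }" := {fraction {poly R}} (format "{ 'ratfun'  R }").

(* A finite set F = {f_1 < ... < f_k} of positive integers is the strictly
   increasing sequence [:: f_1; ...; f_k]. *)
Section IndexSets.

Definition pos_set (F : seq nat) : bool := sorted ltn F && all (ltn 0) F.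

Definition fmax (F : seq nat) : nat := last 0%N F.

(* F minus its largest element *)
Definition fdrop (F : seq nat) : seq nat := take (size F).-1 F.

(* The subtraction does not truncate: see [leq_bin_sum]. *)
Definition uF (F : seq nat) : nat := (\sum_(f <- F) f - 'C((size F).+1, 2))%N.

Definition sigmaF (F : seq nat) : pred nat :=
  [pred n | (uF F <= n)%N && ((n - uF F)%N \notin F)].

Lemma leq_bin_sum F : pos_set F -> ('C((size F).+1, 2) <= \sum_(f <- F) f)%N.
Proof.
case/andP=> sF pF.
suff H m : all (ltn m) F -> (m * size F + 'C((size F).+1, 2) <= \sum_(f <- F) f)%N.
  exact: H pF.
elim: F sF m {pF} => [|x s IHs] /=; first by move=> _ m _; rewrite big_nil muln0.
rewrite (path_sortedE ltn_trans) => /andP[xs ss] m /andP[mx ms].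
rewrite big_cons binS bin1 mulnS.
have := leq_add mx (IHs ss m.+1 _); rewrite mulSn => H.
apply: leq_trans (H _); first by lia.
by apply: sub_all xs => y; apply: leq_ltn_trans.
Qed.

Lemma pos_set_rcons F f : pos_set (rcons F f) -> pos_set F.
Proof.
rewrite /pos_set all_rcons => /andP[sF /andP[_ ->]]; rewrite andbT.
by apply: (subseq_sorted ltn_trans) sF; apply: subseq_rcons.
Qed.

Lemma fdrop_rcons F f : fdrop (rcons F f) = F.
Proof. by rewrite /fdrop size_rcons -cats1 take_size_cat. Qed.

Lemma uF_fdrop F : pos_set F -> (0 < size F)%N ->
  (uF F + size F = uF (fdrop F) + fmax F)%N.
Proof.
case/lastP: F => // F f posF _; have posF' := pos_set_rcons posF.
move: (leq_bin_sum posF) (leq_bin_sum posF').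
rewrite /fmax last_rcons fdrop_rcons /uF size_rcons -cats1 big_cat big_seq1 /=.
by rewrite (binS (size F).+1) bin1; lia.
Qed.

(* The index n - f_k + k of the argument of [opA], written n + k - f_k, does not truncate
   and is an admissible index for F minus its largest element. *)
Lemma sigmaF_fdrop F n : pos_set F -> (0 < size F)%N -> n \in sigmaF F ->
  (fmax F <= n + size F)%N /\ (n + size F - fmax F)%N \in sigmaF (fdrop F).
Proof.
move=> posF F0; have eu := uF_fdrop posF F0.
rewrite !inE => /andP[le_un nF]; split; first by lia.
have -> : (n + size F - fmax F - uF (fdrop F) = n - uF F)%N by lia.
apply/andP; split; first by lia.
by apply: contraNN nF; apply: mem_take.
Qed.

End IndexSets.

Section Charlier.
Variable R : fieldType.
Implicit Types (p q : {poly R}) (r : {ratfun R}) (a : R) (F : seq nat).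

Definition pshift (l : int) p : {poly R} := p \Po ('X + (l%:~R)%:P).

(* Substitution x |-> x + l in numerator and denominator of a representative;
   independent of the representative by [fshift_div]. *)
Definition fshift (l : int) r : {ratfun R} :=
  (pshift l \n_(repr r))%:F / (pshift l \d_(repr r))%:F.

(* x (x - 1) ... (x - j + 1) / j! *)
Definition binom_poly (j : nat) : {poly R} :=
  (j`!%:R)^-1 *: \prod_(i < j) ('X - (i%:R)%:P).

Definition charlier a (n : nat) : {poly R} :=
  (n`!%:R)^-1 *:
    \sum_(j < n.+1) ((- a) ^+ (n - j) * 'C(n, j)%:R * j`!%:R) *: binom_poly j.

Definition charlierF a F (n : nat) : {poly R} :=
  \det (\matrix_(i < (size F).+1, j < (size F).+1)
          pshift j%:Z (charlier a (nth 0%N ((n - uF F)%N :: F) i))).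

Definition OmegaF a F : {poly R} :=
  \det (\matrix_(i < size F, j < size F) pshift j%:Z (charlier a (nth 0%N F i))).

(* Column shifts 0, 1, ..., k - 2, k with k = size F. *)
Definition LambdaF a F : {poly R} :=
  \det (\matrix_(i < size F, j < size F)
          pshift (if j.+1 == size F then j.+1 else j)%:Z
                 (charlier a (nth 0%N F i))).

(* Omega_F (x + l) and Lambda_F (x + l) as rational functions of x.  In
   characteristic 0, Omega_F is nonzero for a strictly increasing F, being a
   Casorati determinant of polynomials of distinct degrees. *)
Definition Om a F (l : int) : {ratfun R} := (pshift l (OmegaF a F))%:F.
Definition La a F (l : int) : {ratfun R} := (pshift l (LambdaF a F))%:F.

(* A difference operator \sum_l h_l s_l with rational coefficients is the map
   r |-> \sum_l h_l * r (x + l) on the field of rational functions; the product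
   of operators is composition.  Distinct shifts are linearly independent over
   the rational functions in characteristic 0, so equality of these maps is
   equality of all the coefficients. *)
Definition opD a F : {ratfun R} -> {ratfun R} := fun r =>
  - ('X)%:F * (Om a F 1 / Om a F 0) * fshift (-1) r
  + (('X)%:F + (size F)%:R + (a%:P)%:F + (uF F)%:R
     - (a%:P)%:F * (La a F 1 / Om a F 1)
     + (a%:P)%:F * (La a F 0 / Om a F 0)) * fshift 0 r
  - (a%:P)%:F * (Om a F 0 / Om a F 1) * fshift 1 r.

Definition opA a F : {ratfun R} -> {ratfun R} := fun r =>
  Om a F 1 / Om a (fdrop F) 1 * fshift 0 r
  - Om a F 0 / Om a (fdrop F) 1 * fshift 1 r.

Definition opB a F : {ratfun R} -> {ratfun R} := fun r =>
  - ('X)%:F * (Om a (fdrop F) 1 / Om a F 0) * fshift (-1) r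
  + (a%:P)%:F * (Om a (fdrop F) 0 / Om a F 0) * fshift 0 r.

End Charlier.

Section Sanity.
Variable R : fieldType.
Implicit Types (p q : {poly R}) (a : R).

Lemma pshift_eq0 l p : (pshift l p == 0) = (p == 0).
Proof.
by rewrite /pshift comp_poly2_eq0 // size_XaddC.
Qed.

Lemma numdenE (r : {ratfun R}) : (\n_(repr r))%:F / (\d_(repr r))%:F = r.
Proof.
rewrite -[RHS]reprK; case: (repr r) => -[x y] /= y0.
apply: (canLR (mulfK _)); first by rewrite tofrac_eq0.
rewrite !piE; apply/eqmodP; rewrite /= FracField.equivfE /FracField.mulf.
by rewrite !numden_Ratio ?oner_neq0 //= ?mulr1 ?mul1r ?numden_Ratio ?mulr1 // mulrC.
Qed.

Lemma fshift_div l p q : q != 0 ->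
  fshift l (p%:F / q%:F) = (pshift l p)%:F / (pshift l q)%:F.
Proof.
move=> q0; rewrite /fshift; set r := p%:F / q%:F.
set n := \n_(repr r); set d := \d_(repr r).
have d0 : d != 0 by exact: denom_ratioP.
have er : n%:F / d%:F = r by exact: numdenE.
have e : n * q = p * d.
  apply/eqP; rewrite -tofrac_eq !tofracM -eqr_div ?tofrac_eq0 //.
  exact/eqP.
apply/eqP; rewrite eqr_div ?tofrac_eq0 ?pshift_eq0 //.
by rewrite -!tofracM /pshift -!comp_polyM e.
Qed.

Lemma fshift0 (r : {ratfun R}) : fshift 0 r = r.
Proof.
rewrite /fshift /pshift mulr0z addr0 !comp_polyXr.
exact: numdenE.
Qed.

Lemma opD_nil a (r : {ratfun R}) :
  opD a [::] r = - ('X)%:F * fshift (-1) r + (('X)%:F + (a%:P)%:F) * fshift 0 r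
                 - (a%:P)%:F * fshift 1 r.
Proof.
rewrite /opD /Om /La /OmegaF /LambdaF /uF !det_mx00 big_nil.
by rewrite /pshift !comp_polyC tofrac1 invr1 !mulr1 !addr0 subrK.
Qed.

Lemma charlierF_nil a n : charlierF a [::] n = charlier a n.
Proof.
rewrite /charlierF det_mx11 mxE /uF big_nil /= subn0.
by rewrite /pshift mulr0z addr0 comp_polyXr.
Qed.

End Sanity.

(* Main.v *)
Require Import Defs.
From HB Require Import structures.
From mathcomp Require Import all_boot all_order all_algebra perm fraction reals.
From mathcomp Require Import ring zify.

(* Write F = G + {f}.  The Desnanot-Jacobi identity for the matrix of c_n^F gives
   c_n^F = A_F c_m^G; with a unit vector as first row it gives
     Omega_G(x) Omega_F(x+1) + Lambda_G(x+1) Omega_F(x) = Lambda_F(x) Omega_G(x+1)   (P).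
   The s_0 coefficient of D_G = B_F A_F + (f + u_G) says exactly that Omega_F is an
   eigenfunction of D_G for the eigenvalue f + u_G; it is one because, up to sign,
   Omega_F = c_{f+u_G}^G and D_G c_n^G = n c_n^G.  By (P), the s_0 coefficient of
   D_F = A_F B_F + (f + u_F) is a consequence of that eigenvalue equation shifted by 1.
   Finally D_F c_n^F = n c_n^F follows from the three identities, so everything is proved
   by induction on the size of F, starting from the difference equation of the Charlier
   polynomials. *)

Set Implicit Arguments.
Unset Strict Implicit.
Unset Printing Implicit Defensive.

Import Order.TTheory GRing.Theory Num.Theory.
Local Open Scope ring_scope.

(** * Bordered Casorati determinants and the Desnanot-Jacobi identity *)

Section Bordered.
Variable K : fieldType.
Implicit Types (g : nat -> nat -> K) (r : nat -> K).

(** All determinants are cut out of one infinite array: [m] counts the rows used and [l] is the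
    first column, which acts as the shift of x. *)
Definition casorati (g : nat -> nat -> K) (m l : nat) : K :=
  \det (\matrix_(i < m, j < m) g i (j + l)%N).

Definition border (g : nat -> nat -> K) (r : nat -> K) (m l : nat) : K :=
  \det (\matrix_(i < m.+1, j < m.+1)
          (if (i : nat) is i'.+1 then g i' (j + l)%N else r (j + l)%N)).

Lemma borderE g r m l :
  border g r m l = \sum_(j < m.+1) r (j + l)%N *
    ((-1) ^+ j * \det (\matrix_(i < m, p < m) g i (bump j p + l)%N)).
Proof.
rewrite /border (expand_det_row _ ord0); apply: eq_bigr => j _.
rewrite !mxE /cofactor add0n; congr (_ * (_ * \det _)).
by apply/matrixP => i p; rewrite !mxE.
Qed.

Lemma border_sum g (s : nat -> nat -> K) (c : nat -> K) (r : nat -> K) m l n :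
    (forall j, (j < m.+1)%N -> r (j + l)%N = \sum_(i < n) c i * s i (j + l)%N) ->
  border g r m l = \sum_(i < n) c i * border g (s i) m l.
Proof.
move=> rE; rewrite borderE.
under [RHS]eq_bigr do rewrite borderE mulr_sumr.
rewrite exchange_big; apply: eq_bigr => j _ /=.
by rewrite rE // mulr_suml; apply: eq_bigr => i _; rewrite mulrA.
Qed.

Lemma border_row g m l i : (i < m)%N -> border g (g i) m l = 0.
Proof.
move=> im; rewrite /border.
rewrite (@determinant_alternate _ _ _ ord0 (Ordinal (im : i.+1 < m.+1)%N)) //.
by move=> j; rewrite !mxE.
Qed.

(** Moving the first row to the bottom crosses [m] rows. The Laplace expansions along the first and
    along the last row agree term by term up to this sign. *)
Lemma border_last g m l :
  border g (g m) m l = (-1) ^+ m * casorati g m.+1 l.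
Proof.
rewrite borderE /casorati (expand_det_row _ ord_max) mulr_sumr.
apply: eq_bigr => j _; rewrite !mxE /cofactor /= exprD.
have -> : \matrix_(i < m, p < m) g i (bump j p + l)%N =
   row' ord_max (col' j (\matrix_(i < m.+1, j0 < m.+1) g i (j0 + l)%N)).
  apply/matrixP => i p; rewrite !mxE /=.
  have im : (i < m)%N := ltn_ord i.
  by rewrite /(bump m) leqNgt im.
rewrite [RHS]mulrCA; congr (_ * _); rewrite !mulrA -expr2 sqrr_sign mul1r //.
Qed.

Lemma border_delta g m l p : (p <= m)%N ->
  border g (fun j => (j == p + l)%N%:R) m l =
  (-1) ^+ p * \det (\matrix_(i < m, j < m) g i (bump p j + l)%N).
Proof.
move=> pm; rewrite borderE (bigD1 (Ordinal (pm : p < m.+1)%N)) //= eqxx mul1r.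
rewrite big1 ?addr0 // => j /eqP jp; rewrite eqn_add2r.
by case: eqP => [e|]; rewrite ?mul0r //; case: jp; apply: val_inj.
Qed.

Lemma border_eq0 g r m l : (forall j, (j <= m)%N -> r (j + l)%N = 0) ->
  border g r m l = 0.
Proof.
by move=> r0; rewrite borderE big1 // => j _; rewrite r0 ?mul0r // -ltnS.
Qed.

(* Both sides are linear in [r]; they agree on the rows of [g] and on the first
   unit vector, which span because [casorati g m.+1 1 != 0]. *)
Lemma desnanot_jacobi g r m : casorati g m.+1 1 != 0 ->
  border g r m.+1 0 * casorati g m 1 =
  casorati g m.+1 1 * border g r m 0 - casorati g m.+1 0 * border g r m 1.
Proof.
move=> W0.
pose s i := if i is i'.+1 then g i' else fun j => (j == 0)%N%:R : K.
(* The rows of [Q] are the first unit vector and [m.+1] rows of [g]. Expanding along the unit vector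
   deletes column 0, which is the shift by 1. *)
pose Q : 'M[K]_(m.+2) := \matrix_(i, j) s i j.
have detQ : \det Q = casorati g m.+1 1.
  rewrite -[RHS]mul1r -(expr0 (-1)); have := @border_delta g m.+1 0 0 isT.
  rewrite addn0 /border => H; transitivity (\det (\matrix_(i < m.+2, j < m.+2)
    (if (i : nat) is i'.+1 then g i' (j + 0)%N else (j + 0 == 0)%N%:R))).
    congr (\det _); apply/matrixP => i j; rewrite !mxE addn0 /s.
    by case: (i : nat).
  rewrite H; congr (_ * \det _); apply/matrixP => i j; rewrite !mxE.
  by rewrite /bump addn0 add1n addn1.
have Qu : Q \in unitmx by rewrite unitmxE unitfE detQ.
pose v := (\row_j r j) *m invmx Q.
pose c i := v 0 (inord i).
have rE j : (j < m.+2)%N -> r j = \sum_(i < m.+2) c i * s i j.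
  move=> jm; have : (v *m Q) 0 (Ordinal jm) = r j by rewrite mulmxKV // mxE.
  rewrite mxE => <-; apply: eq_bigr => i _; rewrite !mxE /c inord_val.
  by rewrite !mxE.
rewrite (@border_sum g s c r m.+1 0 m.+2); last by move=> j ?; rewrite addn0 rE.
rewrite (@border_sum g s c r m 0 m.+2); last by move=> j ?; rewrite addn0 rE //; lia.
rewrite (@border_sum g s c r m 1 m.+2); last by move=> j ?; rewrite addn1 rE //; lia.
rewrite mulr_suml !mulr_sumr -sumrB; apply: eq_bigr => -[[|i] im] _ /=.
- have eW n : border g (fun j => (j == 0)%N%:R) n 0 = casorati g n 1.
    rewrite (@border_delta g n 0 0) // expr0 mul1r; congr (\det _).
    by apply/matrixP => i j; rewrite !mxE /bump addn0 add1n addn1.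
  have -> : border g (fun j => (j == 0)%N%:R) m 1 = 0.
    by apply: border_eq0 => j _; rewrite addn1.
  by rewrite !eW; ring.
(* For row [m] of [g] the left side vanishes and the two terms on the right cancel by [border_last];
   for an earlier row every bordered determinant has a repeated row. *)
- move: im; rewrite !ltnS leq_eqVlt => /orP[/eqP ->|im].
    by rewrite [border g (g m) m.+1 0]border_row // !border_last; ring.
  by rewrite !border_row // ?mulr0 ?mul0r ?mulr0 ?subrr // ltnW.
Qed.

End Bordered.

(** * Shifts as ring morphisms of polynomials and of rational functions *)

Section Shift.
Variable R : fieldType.
Implicit Types (p q : {poly R}) (r s : {ratfun R}) (l m : int).

Lemma pshift_is_zmod_morphism l : zmod_morphism (@pshift R l).
Proof. by move=> p q; rewrite /pshift raddfB. Qed.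

Lemma pshift_is_monoid_morphism l : monoid_morphism (@pshift R l).
Proof. by split=> [|p q]; rewrite /pshift ?rmorph1 ?rmorphM. Qed.

HB.instance Definition _ l := GRing.isZmodMorphism.Build _ _ (@pshift R l)
  (pshift_is_zmod_morphism l).
HB.instance Definition _ l := GRing.isMonoidMorphism.Build _ _ (@pshift R l)
  (pshift_is_monoid_morphism l).

Lemma pshiftD l m p : pshift l (pshift m p) = pshift (l + m) p.
Proof.
rewrite /pshift -comp_polyA comp_polyD comp_polyX comp_polyC intrD polyCD.
by rewrite addrA.
Qed.

Lemma pshift0 p : pshift 0 p = p.
Proof. by rewrite /pshift mulr0z addr0 comp_polyXr. Qed.

Lemma pshiftC l (c : R) : pshift l c%:P = c%:P.
Proof. exact: comp_polyC. Qed.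

Lemma pshiftZ l c p : pshift l (c *: p) = c *: pshift l p.
Proof. exact: comp_polyZ. Qed.

Lemma pshiftX l : pshift l 'X = 'X + (l%:~R)%:P :> {poly R}.
Proof. exact: comp_polyX. Qed.

Lemma fshift_tofrac l p : fshift l p%:F = (pshift l p)%:F.
Proof.
rewrite -[p%:F]divr1 -tofrac1 fshift_div ?oner_neq0 // rmorph1 tofrac1 divr1 //.
Qed.

Lemma ratfun_div r : exists p q, q != 0 /\ r = p%:F / q%:F.
Proof.
exists \n_(repr r), \d_(repr r); split; first exact: denom_ratioP.
by rewrite numdenE.
Qed.

Lemma fshift_is_zmod_morphism l : zmod_morphism (@fshift R l).
Proof.
move=> r s; have [p [q [q0 ->]]] := ratfun_div r.
have [p' [q' [q'0 ->]]] := ratfun_div s.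
have e (u v x y : {poly R}) : v != 0 -> y != 0 ->
    u%:F / v%:F - x%:F / y%:F = (u * y - x * v)%:F / (v * y)%:F.
  by move=> v0 y0; rewrite -mulNr addf_div ?tofrac_eq0 // mulNr tofracB !tofracM.
by rewrite e // !fshift_div ?mulf_neq0 // e ?pshift_eq0 // rmorphB !rmorphM.
Qed.

Lemma fshift_is_monoid_morphism l : monoid_morphism (@fshift R l).
Proof.
split=> [|r s]; first by rewrite -tofrac1 fshift_tofrac rmorph1.
have [p [q [q0 ->]]] := ratfun_div r.
have [p' [q' [q'0 ->]]] := ratfun_div s.
by rewrite mulf_div -!tofracM !fshift_div ?mulf_neq0 // mulf_div -!tofracM !rmorphM.
Qed.

HB.instance Definition _ l := GRing.isZmodMorphism.Build _ _ (@fshift R l)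
  (fshift_is_zmod_morphism l).
HB.instance Definition _ l := GRing.isMonoidMorphism.Build _ _ (@fshift R l)
  (fshift_is_monoid_morphism l).

Lemma fshiftD l m r : fshift l (fshift m r) = fshift (l + m) r.
Proof.
have [p [q [q0 ->]]] := ratfun_div r.
by rewrite !fshift_div ?pshift_eq0 // !pshiftD.
Qed.

End Shift.

(** * The difference equation of the Charlier polynomials *)

Section Charlier.
Variable R : numFieldType.
Implicit Types (a : R) (n j : nat).

Lemma binom_polyS j :
  (j.+1)%:R *: binom_poly R j.+1 = binom_poly R j * ('X - (j%:R)%:P).
Proof.
rewrite /binom_poly big_ord_recr /= scalerA factS natrM invfM mulrA.
by rewrite divff ?pnatr_eq0 // mul1r scalerAl.
Qed.

(** Absorption: after the shift by -1 the factors are x - 1, ..., x - j, and x supplies the missing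
    one. *)
Lemma mulX_pshift_binom j :
  'X * pshift (-1) (binom_poly R j) = (j.+1)%:R *: binom_poly R j.+1.
Proof.
rewrite /binom_poly big_ord_recl /= scalerA factS natrM invfM mulrA.
rewrite divff ?pnatr_eq0 // mul1r -!mul_polyC rmorphM /= pshiftC mulrCA.
rewrite subr0 rmorph_prod /=; congr (_ * (_ * _)); apply: eq_bigr => i _.
rewrite rmorphB /= pshiftC pshiftX /bump /= add1n mulrS polyCD opprD addrA.
by rewrite mulrN1z polyCN.
Qed.

Lemma pshift_binom_polyS j :
  pshift 1 (binom_poly R j.+1) = binom_poly R j.+1 + binom_poly R j.
Proof.
have j0 : (j.+1%:R : R) != 0 by rewrite pnatr_eq0.
apply: (scalerI j0); rewrite scalerDr binom_polyS.
have := congr1 (pshift 1) (mulX_pshift_binom j).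
rewrite rmorphM /= pshiftD subrr pshift0 pshiftX -!mul_polyC rmorphM /= pshiftC.
move=> <-; rewrite -[j.+1%:R]natr1 polyCD mulr1z; ring.
Qed.

Lemma binom_poly0 : binom_poly R 0 = 1.
Proof. by rewrite /binom_poly big_ord0 invr1 scale1r. Qed.

(** The coefficient form of the generating function e^(-az) (1 + z)^x, in which differences act
    termwise. *)
Lemma charlierE a n :
  charlier a n = \sum_(j < n.+1) ((- a) ^+ (n - j) / (n - j)`!%:R) *: binom_poly R j.
Proof.
rewrite /charlier scaler_sumr; apply: eq_bigr => j _; rewrite scalerA.
congr (_ *: _); have jn : (j <= n)%N by rewrite -ltnS.
rewrite -(bin_fact jn) !natrM; field.
by rewrite !pnatr_eq0 -!lt0n !fact_gt0 bin_gt0 jn.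
Qed.

Lemma pshift_charlierS a n :
  pshift 1 (charlier a n.+1) = charlier a n.+1 + charlier a n.
Proof.
rewrite !charlierE rmorph_sum big_ord_recl [in RHS]big_ord_recl /= -addrA.
rewrite -big_split /= -!mul_polyC rmorphM /= !pshiftC binom_poly0 rmorph1.
congr (_ + _); apply: eq_bigr => j _.
by rewrite -!mul_polyC rmorphM /= pshiftC pshift_binom_polyS subSS mulrDr.
Qed.

Lemma charlier0 a : charlier a 0 = 1.
Proof. by rewrite charlierE big_ord1 binom_poly0 expr0 divr1 scale1r. Qed.

Lemma charlier_eigen a n :
  - 'X * pshift (-1) (charlier a n) + ('X + a%:P) * charlier a n
    - a%:P * pshift 1 (charlier a n) = n%:R * charlier a n.
Proof.
have nablaE j : 'X * (binom_poly R j - pshift (-1) (binom_poly R j)) = j%:R *: binom_poly R j.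
  rewrite mulrBr mulX_pshift_binom binom_polyS -mul_polyC; ring.
case: n => [|n]; first by rewrite charlier0 !rmorph1; ring.
(* In terms of the backward and forward differences the operator is x nabla - a Delta, and Delta
   lowers the index by one. *)
transitivity ('X * (charlier a n.+1 - pshift (-1) (charlier a n.+1)) - a%:P * charlier a n).
  by rewrite pshift_charlierS; ring.
rewrite !charlierE rmorph_sum -sumrB [in LHS]mulr_sumr [in RHS]mulr_sumr.
(* In the binomial basis x nabla multiplies the j-th term by j, while - a Delta multiplies it by n +
   1 - j; together they give the eigenvalue n + 1. *)
have -> : a%:P * (\sum_(j < n.+1) ((- a) ^+ (n - j) / (n - j)`!%:R) *: binom_poly R j)
    = \sum_(j < n.+2) - ((n.+1 - j)%:R *
        (((- a) ^+ (n.+1 - j) / (n.+1 - j)`!%:R) *: binom_poly R j)).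
  rewrite [RHS]big_ord_recr /= subnn mul0r oppr0 addr0 mulr_sumr.
  apply: eq_bigr => j _; have jn : (j <= n)%N by rewrite -ltnS.
  rewrite subSn // exprS factS natrM -!mul_polyC -polyC_natr mulrA mulrA -mulNr.
  rewrite -!polyCM -polyCN; congr (_%:P * _); field.
  by rewrite nat1r !pnatr_eq0 -!lt0n fact_gt0.
rewrite -sumrB; apply: eq_bigr => j _ /=.
rewrite opprK pshiftZ -scalerBr -scalerAr nablaE -!mul_polyC.
have jn : (j <= n.+1)%N by rewrite -ltnS.
by rewrite natrB // polyC_natr; ring.
Qed.

(** * Nonvanishing of Omega_F *)

Lemma size_binom_poly j : size (binom_poly R j) = j.+1.
Proof.
rewrite /binom_poly size_scale ?invr_eq0 ?pnatr_eq0 -?lt0n ?fact_gt0 //.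
by rewrite size_prod_XsubC /index_enum -enumT size_enum_ord.
Qed.

Lemma size_charlier a n : (size (charlier a n) <= n.+1)%N.
Proof.
rewrite charlierE; apply: (leq_trans (size_sum _ _ _)).
by apply/bigmax_leqP => j _; rewrite (leq_trans (size_scale_leq _ _)) ?size_binom_poly.
Qed.

Lemma coef_charlier a n : (charlier a n)`_n = n`!%:R^-1.
Proof.
rewrite charlierE coef_sum big_ord_recr /= big1 ?add0r => [|j _]; last first.
  by rewrite coefZ nth_default ?mulr0 // size_binom_poly.
rewrite subnn expr0 divr1 scale1r /binom_poly coefZ.
have := monicP (monic_prod_XsubC (index_enum 'I_n) xpredT (fun i => (i%:R : R))).
by rewrite lead_coefE size_prod_XsubC /index_enum -enumT size_enum_ord => ->; rewrite mulr1.
Qed.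

(* The [m]-th forward difference of [charlier a n]. *)
Definition charlier_diff a n m : {poly R} :=
  if (m <= n)%N then charlier a (n - m) else 0.

Lemma pshift_charlier_diff a n m :
  pshift 1 (charlier_diff a n m) = charlier_diff a n m + charlier_diff a n m.+1.
Proof.
rewrite /charlier_diff; case: (leqP m n) => [mn|nm]; last first.
  by rewrite ltnNge (ltnW nm) rmorph0 addr0.
case: ltnP => [mn'|].
  by rewrite subnS -(ltn_predK (n := n - m) (m := 0)) ?subn_gt0 // pshift_charlierS.
move=> nm; have -> : (n - m)%N = 0 by lia.
by rewrite charlier0 rmorph1 addr0.
Qed.

(** Newton's forward difference formula. The sum runs to a common bound [k], the terms beyond [j]
    being zero, so that it can be read as a matrix product. *)
Lemma pshift_charlier_binom a n j k : (j < k)%N ->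
  pshift j%:Z (charlier a n) = \sum_(m < k) 'C(j, m)%:R *: charlier_diff a n m.
Proof.
elim: j k => [|j IHj] [|k] //; rewrite ltnS => jk.
  rewrite pshift0 big_ord_recl big1 => [|i _]; last by rewrite /= bin0n scale0r.
  by rewrite bin0 scale1r addr0 /charlier_diff subn0.
rewrite -[j.+1]add1n PoszD -pshiftD (IHj k.+1) 1?ltnW // rmorph_sum /=.
under eq_bigr do rewrite -mul_polyC rmorphM /= pshiftC pshift_charlier_diff mulrDr.
rewrite big_split /= [X in _ + X]big_ord_recr /= bin_small // mul0r addr0.
rewrite add1n big_ord_recl [RHS]big_ord_recl !bin0 -mul_polyC -addrA; congr (_ + _).
rewrite -big_split; apply: eq_bigr => i _ /=.
by rewrite binS natrD -mul_polyC polyCD mulrDl.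
Qed.

(** Each Leibniz term takes one entry from every row, so its degree is at most the sum of the row
    bounds. *)
Lemma coef_det_rowdeg k (A : 'M[{poly R}]_k) (d : nat -> nat) :
    (forall i j : 'I_k, (size (A i j) <= (d i).+1)%N) ->
  (\det A)`_(\sum_(i < k) d i) = \det (\matrix_(i, j) (A i j)`_(d i)).
Proof.
move=> sA; rewrite /determinant coef_sum; apply: eq_bigr => s _.
have coef_prod (I : Type) (r : seq I) (P : I -> {poly R}) (e : I -> nat) :
    (forall i, (size (P i) <= (e i).+1)%N) ->
    (\prod_(i <- r) P i)`_(\sum_(i <- r) e i) = \prod_(i <- r) (P i)`_(e i)
    /\ (size (\prod_(i <- r) P i)%R <= (\sum_(i <- r) e i).+1)%N.
  move=> sP; elim: r => [|i r [IH1 IH2]]; first by rewrite !big_nil coef1 size_poly1.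
  rewrite !big_cons; split; last first.
    apply: leq_trans (size_polyMleq _ _) _; have := sP i; lia.
  rewrite coefM (bigD1 (inord (e i))) //= inordK ?ltnS ?leq_addr // addKn IH1.
  rewrite [X in _ + X]big1 ?addr0 // => j /eqP ji.
  have [je|je] := ltnP (e i) j; first by rewrite nth_default ?mul0r // (leq_trans (sP i)).
  rewrite [X in _ * X]nth_default ?mulr0 // (leq_trans IH2) //.
  have : (j : nat) <> e i.
    by move=> E; apply: ji; apply: val_inj; rewrite /= inordK ?ltnS ?leq_addr.
  lia.
have [E _] := coef_prod _ (index_enum 'I_k) (fun i => A i (s i)) (fun i => d i)
  (fun i => sA i (s i)).
rewrite !mulr_sign; under [in RHS]eq_bigr do rewrite mxE.
by case: (odd_perm s); rewrite ?coefN E.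
Qed.

Lemma horner_binom_poly j n : (binom_poly R j).[n%:R] = 'C(n, j)%:R.
Proof.
elim: j => [|j IHj]; first by rewrite binom_poly0 hornerC bin0.
have j0 : (j.+1%:R : R) != 0 by rewrite pnatr_eq0.
apply: (mulfI j0); rewrite -hornerZ binom_polyS hornerM IHj !hornerE -natrM.
rewrite mul_bin_left; have [jn|nj] := leqP j n; first by rewrite mulnC natrM natrB.
by rewrite bin_small // mul0r muln0.
Qed.

Lemma binom_poly_free k (v : nat -> R) :
  \sum_(j < k) v j *: binom_poly R j = 0 -> forall j, (j < k)%N -> v j = 0.
Proof.
elim: k => // k IHk; rewrite big_ord_recr /= => v0.
have vk : v k = 0.
  have := congr1 (fun p : {poly R} => p`_k) v0.
  rewrite coefD coef_sum big1 ?add0r => [|j _]; last first.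
    by rewrite coefZ nth_default ?mulr0 // size_binom_poly.
  rewrite coefZ coef0 => /eqP; rewrite mulf_eq0 => /orP[/eqP //|].
  by rewrite -[k in _`_k]/(k.+1.-1) -{1}(size_binom_poly k) -lead_coefE
    lead_coef_eq0 -size_poly_eq0 size_binom_poly.
move: v0; rewrite vk scale0r addr0 => /IHk H j; rewrite ltnS leq_eqVlt.
by case/orP => [/eqP -> //|/H].
Qed.

(** A kernel vector v would make the sum of j! v_j binom(x, j), of degree less than [size F], vanish
    at the [size F] distinct points of [F]. *)
Lemma det_inv_fact_neq0 (F : seq nat) : uniq F ->
  \det (\matrix_(i < size F, j < size F)
    (if (j <= nth 0%N F i)%N then (nth 0%N F i - j)`!%:R^-1 else 0 : R)) != 0.
Proof.
move=> uF; set L := matrix_of_fun _ _; rewrite -det_tr.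
apply/negP => /det0P[v v0 vL]; case/eqP: v0; apply/rowP => j; rewrite mxE.
pose w (i : nat) : R := if insub i is Some i' then i`!%:R * v 0 i' else 0.
have wE (i : 'I_(size F)) : w i = i`!%:R * v 0 i by rewrite /w valK.
suff p0 : \sum_(i < size F) w i *: binom_poly R i = 0.
  have := binom_poly_free p0 (ltn_ord j); rewrite wE => /eqP.
  by rewrite mulf_eq0 pnatr_eq0 -leqn0 leqNgt fact_gt0 => /eqP.
apply: (@roots_geq_poly_eq0 _ _ [seq f%:R | f <- F]).
- apply/allP => _ /mapP[f fF ->]; rewrite /root horner_sum; apply/eqP.
  have iF : (index f F < size F)%N by rewrite index_mem.
  have := congr1 (fun M : 'rV_(size F) => M 0 (Ordinal iF)) vL.
  rewrite !mxE => /(congr1 (fun x => f`!%:R * x)); rewrite mulr0 mulr_sumr.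
  move=> E; rewrite -[RHS]E; apply: eq_bigr => i _.
  rewrite hornerZ horner_binom_poly wE !mxE nth_index //=.
  case: leqP => [le_if|?]; last by rewrite bin_small // !mulr0.
  rewrite -(bin_fact le_if) !natrM; field.
  by rewrite pnatr_eq0 -lt0n fact_gt0.
- by rewrite map_inj_uniq // => m n /eqP; rewrite eqr_nat => /eqP.
- rewrite size_map; apply: (leq_trans (size_sum _ _ _)); apply/bigmax_leqP => i _.
  by rewrite (leq_trans (size_scale_leq _ _)) ?size_binom_poly.
Qed.

(** By Newton's formula the Casorati matrix is the matrix [M] of forward differences times a
    unitriangular matrix, so it suffices to study [M]. *)
Lemma OmegaF_neq0 a (F : seq nat) : uniq F -> OmegaF a F != 0.
Proof.
move=> uF; pose k := size F; pose f i := nth 0%N F i.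
pose M : 'M[{poly R}]_k := \matrix_(i, j) charlier_diff a (f i) j.
pose U : 'M[{poly R}]_k := \matrix_(i, j) ('C(j, i)%:R)%:P.
have -> : OmegaF a F = \det (M *m U).
  congr (\det _); apply/matrixP => i j; rewrite !mxE.
  rewrite (pshift_charlier_binom a (f i) (ltn_ord j)); apply: eq_bigr => m _.
  by rewrite !mxE mulrC mul_polyC.
have -> : \det (M *m U) = \det M.
  rewrite det_mulmx -(det_tr U) (@det_trig _ _ U^T) ?[X in _ * X]big1 ?mulr1 // => [i _|].
    by rewrite !mxE binn.
  by apply/is_trig_mxP => i j ij; rewrite !mxE bin_small.
(* Multiplying column j by x^j restores the degree lost by j differences: row i then has degree at
   most f_i, with top coefficients 1 / (f_i - j)!. *)
pose N : 'M[{poly R}]_k := M *m diag_mx (\row_j 'X^j).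
apply/negP => /eqP M0.
have N0 : \det N = 0 by rewrite det_mulmx M0 mul0r.
have NE (i j : 'I_k) : N i j = charlier_diff a (f i) j * 'X^j by rewrite /N mul_mx_diag !mxE.
have := @coef_det_rowdeg k N f; rewrite N0 coef0 => detN.
have /eqP := det_inv_fact_neq0 uF; apply; rewrite [RHS]detN => [|i j].
  congr (\det _); apply/matrixP => i j; rewrite mxE [RHS]mxE NE coefMXn /charlier_diff.
  by rewrite -/(f i) ltnNge; case: leqP => // ji; rewrite coef_charlier.
rewrite NE /charlier_diff; case: (leqP j (f i)) => [ji|_]; last by rewrite mul0r size_poly0.
rewrite (leq_trans (size_polyMleq _ _)) // size_polyXn addnS /=.
by rewrite -(subnK ji) -addSn leq_add2r addnK size_charlier.
Qed.

End Charlier.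

(** * Field identities behind the two factorizations *)

Section DarbouxAlgebra.
Variable K : fieldType.

(* For F = G + {f}, the letter [v] stands for Omega_F, [w] for Omega_G, [L] for
   Lambda_F, [M] for Lambda_G and [r] for the argument of the operators; the suffix is
   the shift ([m] for -1).  [d] is the s_0 coefficient of D_G and [e] the correction of
   [La_Om_rcons]. *)
Lemma factor_dropped (x a c d vm v0 v1 w0 w1 rm r0 r1 : K) :
    v0 != 0 -> w0 != 0 -> w1 != 0 ->
    - x * (w1 / w0) * vm + d * v0 - a * (w0 / w1) * v1 = c * v0 ->
  - x * (w1 / w0) * rm + d * r0 - a * (w0 / w1) * r1
  = - x * (w1 / v0) * (v0 / w0 * rm - vm / w0 * r0)
    + a * (w0 / v0) * (v1 / w1 * r0 - v0 / w1 * r1) + c * r0.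
Proof.
move=> v00 w00 w10 /esym/(canRL (mulfK v00)) ->; field.
by rewrite v00 w00 w10.
Qed.

(** The hypotheses are the eigenvalue equation of Omega_F shifted by 1, then (P) and its shift by 1.
    The corrections [e] cancel in L1 / v1 - L0 / v0. *)
Lemma factor_full (x a m f u u' e v0 v1 v2 w0 w1 w2 L0 L1 M1 M2 rm r0 r1 : K) :
    v0 != 0 -> v1 != 0 -> w0 != 0 -> w1 != 0 -> w2 != 0 ->
    - (x + 1) * (w2 / w1) * v0
      + (x + 1 + m + a + u' - a * (M2 / w2) + a * (M1 / w1)) * v1
      - a * (w1 / w2) * v2 = (f + u') * v1 ->
    w0 * v1 + (M1 - e * w1) * v0 = L0 * w1 ->
    w1 * v2 + (M2 - e * w2) * v1 = L1 * w2 ->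
  - x * (v1 / v0) * rm
    + (x + (m + 1) + a + u - a * (L1 / v1) + a * (L0 / v0)) * r0
    - a * (v0 / v1) * r1
  = v1 / w1 * (- x * (w1 / v0) * rm + a * (w0 / v0) * r0)
    - v0 / w1 * (- (x + 1) * (w2 / v1) * r0 + a * (w1 / v1) * r1)
    + (f + u) * r0.
Proof.
move=> v00 v10 w00 w10 w20 /esym/(canRL (mulfK v10)) E.
move=> /esym/(canRL (mulfK w10)) -> /esym/(canRL (mulfK w20)) ->.
(* The eigenvalue equation is solved for [f + u'], which has to appear in the goal. *)
have -> : f = f + u' - u' by ring.
by rewrite E; field; rewrite v00 v10 w10 w20.
Qed.

End DarbouxAlgebra.

(** * The operators on rational functions, the factorizations and the eigenvalue equation *)

Section Factorization.
Variable R : numFieldType.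
Implicit Types (a : R) (F G H : seq nat) (f n k m : nat) (r : {ratfun R}).

Definition charlier_row a f (j : nat) : {ratfun R} := (pshift j (charlier a f))%:F.

Definition charlier_rows a F (i : nat) := charlier_row a (nth 0%N F i).

Lemma fshift_charlier_row a f (j l : nat) :
  fshift l (charlier_row a f j) = charlier_row a f (j + l).
Proof. by rewrite /charlier_row fshift_tofrac pshiftD -PoszD addnC. Qed.

Lemma tofrac_det k (A : 'M[{poly R}]_k) : (\det A)%:F = \det (map_mx (@tofrac _) A).
Proof. by rewrite det_map_mx. Qed.

Lemma prefix_nth (x : nat) F H i : prefix F H -> (i < size F)%N -> nth x H i = nth x F i.
Proof. by case/prefixP => G -> iF; rewrite nth_cat iF. Qed.

(** Letting [H] extend [F] allows Omega_G and Omega_F to be read off the same array, as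
    Desnanot-Jacobi requires. *)
Lemma Om_casorati a F H (l : nat) : prefix F H ->
  Om a F l = casorati (charlier_rows a H) (size F) l.
Proof.
move=> FH; rewrite /Om -fshift_tofrac tofrac_det -det_map_mx; congr (\det _).
apply/matrixP => i j; rewrite !mxE /charlier_rows (prefix_nth _ FH) //.
exact: fshift_charlier_row.
Qed.

Lemma charlierF_border a F H n (l : nat) : prefix F H ->
  fshift l (charlierF a F n)%:F
  = border (charlier_rows a H) (charlier_row a (n - uF F)) (size F) l.
Proof.
move=> FH; rewrite /charlierF tofrac_det -det_map_mx; congr (\det _).
apply/matrixP => -[[|i] im] j; rewrite !mxE; first exact: fshift_charlier_row.
rewrite /= /charlier_rows (prefix_nth _ FH) //; exact: fshift_charlier_row.
Qed.

Lemma La_det a F H m (l : nat) : prefix F H -> size F = m.+1 ->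
  La a F l = \det (\matrix_(i < m.+1, j < m.+1) charlier_rows a H i (bump m j + l)).
Proof.
move=> FH sF; rewrite /La -fshift_tofrac /LambdaF sF tofrac_det -det_map_mx.
congr (\det _); apply/matrixP => i j; rewrite !mxE /charlier_rows.
rewrite (prefix_nth _ FH) ?sF //.
have -> : bump m j = if j.+1 == m.+1 then j.+1 else j.
  rewrite /bump eqSS; have := ltn_ord j; rewrite ltnS leq_eqVlt.
  by case: eqP => [->|_] /=; rewrite ?leqnn // ltnNge => /negbTE ->.
exact: fshift_charlier_row.
Qed.

Lemma Om_neq0 a F l : pos_set F -> Om a F l != 0.
Proof.
case/andP => sF _; rewrite tofrac_eq0 pshift_eq0 OmegaF_neq0 //.
exact: sorted_uniq ltn_trans ltnn _ sF.
Qed.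

Lemma prefix_rconsl F f : prefix F (rcons F f).
Proof. by rewrite -cats1 prefix_prefix. Qed.

Lemma fshift_Om a F l l' : fshift l (Om a F l') = Om a F (l + l').
Proof. by rewrite /Om fshift_tofrac pshiftD. Qed.

Lemma fshift_La a F l l' : fshift l (La a F l') = La a F (l + l').
Proof. by rewrite /La fshift_tofrac pshiftD. Qed.

Lemma fshift_tofracX l : fshift l ('X)%:F = ('X)%:F + (l%:~R%:P)%:F :> {ratfun R}.
Proof. by rewrite fshift_tofrac pshiftX tofracD. Qed.

Lemma fshift_tofracC l (c : R) : fshift l (c%:P)%:F = (c%:P)%:F.
Proof. by rewrite fshift_tofrac pshiftC. Qed.

(* The morphism laws are applied to an abstract [phi] since [fshift] and the
   field operations would otherwise be unfolded by unification. *)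
Lemma fshift_opA a F l r :
  fshift l (opA a F r)
  = Om a F (l + 1) / Om a (fdrop F) (l + 1) * fshift l r
    - Om a F l / Om a (fdrop F) (l + 1) * fshift (l + 1) r.
Proof.
have aux (K : fieldType) (phi : {rmorphism K -> K}) x y z w s t :
    phi (x / y * s - z / w * t) = phi x / phi y * phi s - phi z / phi w * phi t.
  by rewrite rmorphB !rmorphM !fmorphV.
rewrite /opA; apply: etrans (aux _ (fshift l) _ _ _ _ _ _) _ => /=.
by rewrite !fshift_Om 2!fshiftD !addr0.
Qed.

Lemma fshift_opB a F l r :
  fshift l (opB a F r)
  = - fshift l ('X)%:F * (Om a (fdrop F) (l + 1) / Om a F l) * fshift (l - 1) r
    + (a%:P)%:F * (Om a (fdrop F) l / Om a F l) * fshift l r.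
Proof.
have aux (K : fieldType) (phi : {rmorphism K -> K}) x y z s b w t u :
    phi (- x * (y / z) * s + b * (w / t) * u)
    = - phi x * (phi y / phi z) * phi s + phi b * (phi w / phi t) * phi u.
  by rewrite rmorphD !rmorphM rmorphN !fmorphV.
rewrite /opB; apply: etrans (aux _ (fshift l) _ _ _ _ _ _ _ _) _ => /=.
by rewrite fshift_tofracC !fshift_Om 2!fshiftD !addr0.
Qed.

Lemma fshift_opD a F l r :
  fshift l (opD a F r)
  = - fshift l ('X)%:F * (Om a F (l + 1) / Om a F l) * fshift (l - 1) r
    + (fshift l ('X)%:F + (size F)%:R + (a%:P)%:F + (uF F)%:R
       - (a%:P)%:F * (La a F (l + 1) / Om a F (l + 1))
       + (a%:P)%:F * (La a F l / Om a F l)) * fshift l r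
    - (a%:P)%:F * (Om a F l / Om a F (l + 1)) * fshift (l + 1) r.
Proof.
have aux (K : fieldType) (phi : {rmorphism K -> K}) x y z s k b n M v N w t u h q :
    phi (- x * (y / z) * s
      + (x + k%:R + b + n%:R - b * (M / v) + b * (N / w)) * t - b * (u / h) * q)
    = - phi x * (phi y / phi z) * phi s
      + (phi x + k%:R + phi b + n%:R - phi b * (phi M / phi v)
         + phi b * (phi N / phi w)) * phi t
      - phi b * (phi u / phi h) * phi q.
  by rewrite !(rmorphB, rmorphD, rmorphN, rmorphM, rmorph_nat, fmorphV).
rewrite /opD; apply: etrans (aux _ (fshift l) _ _ _ _ _ _ _ _ _ _ _ _ _ _ _) _ => /=.
by rewrite !(fshift_Om a F l 0, fshift_Om a F l 1)
  !(fshift_La a F l 0, fshift_La a F l 1) !fshiftD !addr0 fshift_tofracC.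
Qed.

Lemma charlierF_rcons a G f n (H := rcons G f) : pos_set H -> n \in sigmaF H ->
  (charlierF a H n)%:F = opA a H (charlierF a G (n + size H - f))%:F.
Proof.
move=> posH nH.
have w0 : Om a G 1 != 0 by rewrite Om_neq0 // (pos_set_rcons posH).
have H0 : (0 < size H)%N by rewrite size_rcons.
have [] := sigmaF_fdrop posH H0 nH; have := uF_fdrop posH H0.
rewrite fdrop_rcons /fmax last_rcons -/H => eu le_f n'G.
(* Both bordered determinants therefore have the same first row. *)
have en : (n + size H - f - uF G = n - uF H)%N.
  by move: nH n'G => /andP[? _] /andP[? _]; lia.
have := @desnanot_jacobi _ (charlier_rows a H) (charlier_row a (n - uF H)) (size G).
rewrite -(size_rcons G f) -/H -!(Om_casorati _ _ (prefix_refl H)) Om_neq0 // => /(_ isT).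
have FH : prefix G H := prefix_rconsl G f.
rewrite -(Om_casorati _ _ FH) -(charlierF_border _ _ _ (prefix_refl H)).
rewrite -[in border _ _ _ 0]en -[in border _ _ _ 1]en.
rewrite -!(charlierF_border _ _ _ FH) !fshift0 => /(canRL (mulfK w0)) ->.
by rewrite /opA fdrop_rcons fshift0 mulrBl !mulrA ![_ / Om a G 1 * _]mulrAC.
Qed.

(* The minors of F with first row a unit vector are the Omega's and Lambda's;
   for [G = [::]] the convention [LambdaF a [::] = 1] has to be corrected to 0. *)
Lemma La_Om_rcons a G f (H := rcons G f) : pos_set H ->
  Om a G 0 * Om a H 1 + (La a G 1 - (size G == 0)%N%:R * Om a G 1) * Om a H 0
  = La a H 0 * Om a G 1.
Proof.
move=> posH; set m := size G; pose g := charlier_rows a H.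
have FH : prefix G H := prefix_rconsl G f.
have sH : size H = m.+1 by rewrite size_rcons.
have := @desnanot_jacobi _ g (fun j => (j == m)%N%:R) m.
rewrite -sH -!(Om_casorati _ _ (prefix_refl H)) Om_neq0 // => /(_ isT).
rewrite -(Om_casorati _ _ FH) sH.
have -> : border g (fun j => (j == m)%N%:R) m.+1 0 = (-1) ^+ m * La a H 0.
  rewrite (La_det a 0 (prefix_refl H) sH) -[RHS](border_delta g 0 (leqnSn m)).
  by rewrite addn0.
have -> : border g (fun j => (j == m)%N%:R) m 0 = (-1) ^+ m * Om a G 0.
  rewrite (Om_casorati _ _ FH) -/m -{1}[m]addn0 border_delta //; congr (_ * \det _).
  by apply/matrixP => i j; rewrite !mxE /bump leqNgt ltn_ord.
(* Columns now start at 1, so position [m] is column [m - 1] of the determinant; this changes the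
   sign and, for positive [m], leaves Lambda_G. *)
have -> : border g (fun j => (j == m)%N%:R) m 1
    = - ((-1) ^+ m * (La a G 1 - (m == 0)%N%:R * Om a G 1)).
  case em : m => [|m'].
    rewrite border_eq0 => [|j _]; last by rewrite addn1.
    have G0 : G = [::] by apply: size0nil.
    by rewrite /La /Om G0 /LambdaF /OmegaF !det_mx00 eqxx !mul1r subrr oppr0.
  have -> : border g (fun j => (j == m'.+1)%N%:R) m'.+1 1
      = (-1) ^+ m' * \det (\matrix_(i < m'.+1, j < m'.+1) g i (bump m' j + 1)%N).
    by rewrite -(border_delta g 1 (leqnSn m')) addn1.
  rewrite mul0r subr0.
  by rewrite (La_det a 1 FH em) exprS mulN1r mulNr opprK.
have aux (K : fieldType) (s A B C D E X : K) : s != 0 ->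
   s * A * B = C * (s * D) - E * - (s * X) -> D * C + X * E = A * B.
  by move=> s0 e; apply: (mulfI s0); rewrite mulrA e; ring.
by apply: aux; rewrite signr_eq0.
Qed.

(** The induction statement: assumed for [G] in the factorizations, which in turn yield it for
    [rcons G f]. *)
Definition eigen a F := forall n, n \in sigmaF F ->
  opD a F (charlierF a F n)%:F = n%:R * (charlierF a F n)%:F.

(* Up to sign, [OmegaF] of [rcons G f] is the eigenfunction [charlierF a G (f + uF G)]. *)
Lemma opD_Om a G f (H := rcons G f) : pos_set H -> eigen a G ->
  opD a G (Om a H 0) = (f + uF G)%:R * Om a H 0.
Proof.
move=> posH eG; have FH : prefix G H := prefix_rconsl G f.
(* The index is admissible because [f] does not occur in [G]. *)
have fG : (f + uF G)%N \in sigmaF G.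
  rewrite inE leq_addl addnK; case/andP: posH => sH _.
  have := sorted_uniq ltn_trans ltnn sH.
  by rewrite rcons_uniq => /andP[].
have := eG _ fG; rewrite -[(charlierF _ _ _)%:F]fshift0.
rewrite (charlierF_border _ _ _ FH) addnK.
have <- : charlier_rows a H (size G) = charlier_row a f.
  by rewrite /charlier_rows /H nth_rcons ltnn eqxx.
rewrite border_last -(size_rcons G f) -/H -(Om_casorati _ _ (prefix_refl H)).
set s := (-1) ^+ _.
have -> r : opD a G (s * r) = s * opD a G r.
  rewrite /opD !rmorphM !rmorph_sign -/s.
  have aux (K : fieldType) (A B C S x y z : K) :
    A * (S * x) + B * (S * y) - C * (S * z) = S * (A * x + B * y - C * z) by ring.
  exact: aux.
by rewrite [in RHS]mulrCA => /mulfI; apply; rewrite signr_eq0.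
Qed.

Lemma opBA_rcons a G f r (H := rcons G f) : pos_set H -> eigen a G ->
  opD a G r = opB a H (opA a H r) + (f + uF G)%:R * r.
Proof.
move=> posH eG; have := opD_Om posH eG; have posG := pos_set_rcons posH.
rewrite {1}/opB fshift_opA fshift_opA fdrop_rcons -/H /opD !fshift_Om.
rewrite [(-1 + 1)]addNr !add0r !addr0 !fshift0.
by apply: factor_dropped; exact: Om_neq0.
Qed.

Lemma opAB_rcons a G f r (H := rcons G f) : pos_set H -> eigen a G ->
  opD a H r = opA a H (opB a H r) + (f + uF H)%:R * r.
Proof.
move=> posH eG; have posG := pos_set_rcons posH.
have P0 := La_Om_rcons a posH.
have aux (K : fieldType) (phi : {rmorphism K -> K}) x y z w e s t u :
    x * y + (z - e%:R * w) * s = t * u ->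
    phi x * phi y + (phi z - e%:R * phi w) * phi s = phi t * phi u.
  by move/(congr1 phi); rewrite !(rmorphB, rmorphD, rmorphM, rmorph_nat).
have := aux _ (fshift 1) _ _ _ _ _ _ _ _ P0; move: P0 => /=.
have aux' (K : fieldType) (phi : {rmorphism K -> K}) s n t :
  s = n%:R * t -> phi s = n%:R * phi t by move->; rewrite rmorphM rmorph_nat.
have := aux' _ (fshift 1) _ _ _ (opD_Om posH eG) => /=.
rewrite fshift_opD {1}/opA /opD !fshift_opB fdrop_rcons -/H [size H]size_rcons.
rewrite !fshift_tofracX !(fshift_Om a H) !(fshift_Om a G 1).
rewrite (fshift_La a G 1 1) (fshift_La a H 1 0).
rewrite !subrr !addr0 !add0r !fshift0 /=.
rewrite tofrac1 -[(size G).+1%:R]natr1 !natrD.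
apply: factor_full; exact: Om_neq0.
Qed.

(** The factorizations give D_F A_F = A_F (D_G + u_F - u_G), so A_F carries eigenfunctions of D_G to
    eigenfunctions of D_F. *)
Lemma eigen_pos_set a F : pos_set F -> eigen a F.
Proof.
elim/last_ind: F => [_ n _|G f IHG posH].
  rewrite opD_nil charlierF_nil !fshift_tofrac pshift0 -tofracN -tofracD -!tofracM.
  by rewrite -!tofracD -!tofracN -tofracD charlier_eigen tofracM rmorph_nat.
move=> n nH; have eG := IHG (pos_set_rcons posH).
have H0 : (0 < size (rcons G f))%N by rewrite size_rcons.
have [] := sigmaF_fdrop posH H0 nH; have := uF_fdrop posH H0.
rewrite charlierF_rcons // (opAB_rcons _ posH eG).
rewrite fdrop_rcons /fmax last_rcons => eu le_f /eG.
set C := (charlierF a G _)%:F; set H := rcons G f.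
rewrite (opBA_rcons _ posH eG) => /(canRL (addrK _)) ->.
have aux (K : fieldType) (phi : {rmorphism K -> K}) (i j : nat) x y s t :
    x * ((i%:R - j%:R) * s) - y * phi ((i%:R - j%:R) * t)
    = (i%:R - j%:R) * (x * s - y * phi t).
  by rewrite rmorphM rmorphB !rmorph_nat; ring.
rewrite -mulrBl /opA !fshift0 [in LHS]aux /= -mulrDl.
have eqn (K : fieldType) (i j p q : nat) : (i + p = q + j)%N -> i%:R - j%:R + p%:R = q%:R :> K.
  move/(congr1 (fun h => h%:R : K)); rewrite !natrD => e.
  by rewrite addrAC e addrK.
(* With k = [size H], the eigenvalue is (n + k - f) - (f + u_G) + (f + u_H), equal to n since u_H +
   k = u_G + f. *)
by congr (_ * _); apply: eqn; move: eu le_f; rewrite -/H; lia.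
Qed.

End Factorization.

Theorem lemma3p6 (R : realType) (a : R) (F : seq nat)
    (ha : a != 0) (hF : pos_set F) (hk : (1 <= size F)%N) :
  [/\ forall n : nat, n \in sigmaF F ->
        (charlierF a F n)%:F
          = opA a F (charlierF a (fdrop F) (n + size F - fmax F)%N)%:F,
      forall r : {ratfun R},
        opD a (fdrop F) r
          = opB a F (opA a F r) + (fmax F + uF (fdrop F))%:R * r
    & forall r : {ratfun R},
        opD a F r
          = opA a F (opB a F r) + (fmax F + uF F)%:R * r].
Proof.
case/lastP: F => // G f in hF hk *; rewrite fdrop_rcons /fmax last_rcons.
have eG := eigen_pos_set a (pos_set_rcons hF).
by split=> [n|r|r]; [exact: charlierF_rcons | exact: opBA_rcons | exact: opAB_rcons].
Qed.
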